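(* Let $(A,B,C)\neq(6,7,10)$ be a nontrivial solution triple of $A!\,B!=C!$. Then $B\ge 10^{3000}$ and $$\begin{aligned} A&\le \frac{\log(B+1)}{\log2}+\frac{2\log\log(B+1)}{\log2}-1.3479,\\ C-B&\le\frac{\log\log(B+1)}{\log2}-0.8803,\\ B-A&>C-\frac{\log(C+1)}{\log2}-\frac{3\log\log(C+1)}{\log2}+2.2282. \end{aligned}$$
   Context: A nontrivial solution triple of the equation $A!\,B!=C!$ is a triple of positive integers $(A,B,C)$ with $A\le B\le C-2$ satisfying $A!\,B!=C!$. Here $\log$ denotes the natural logarithm. *)

(* Defs.v *)
From Stdlib Require Import Reals ZArith Arith.

(* [A <= B <= C - 2] is written with [B + 2 <= C], so that no truncated
   subtraction on [nat] is involved. *)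
Definition nontrivial_solution (A B C : nat) : Prop :=
  (1 <= A /\ A <= B /\ B + 2 <= C /\ fact A * fact B = fact C)%nat.

(* Main.v *)
Require Import Defs.
From Stdlib Require Import Reals ZArith Znumtheory Zpow_facts Arith List Lia Lra Bool.
Import ListNotations.

(** Put [k = C - B], so that [A! = (B+1)...(B+k)]. The even factors among [k] consecutive
    integers are twice consecutive integers; recursively, the power of 2 dividing the product
    is at most [2^(k-2) (B+k)], while the one dividing [A!] is at least [2^A / (A+1)]. Hence
    [A <= log2 (B+k) + log2 (A+1) + k - 2]. On the other hand [(B+1)^k <= A!], which by
    Stirling's estimate forces [k] to be at most about [log2 A - 1/ln 2]. Combining the two
    gives the asymptotic bounds, with just enough room for the stated constants once
    [B >= 10^3000].

    If [B < 10^3000], the same two facts leave only [A <= 9999] and [k <= 12]. For such a pair,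
    [A!/k! = binomial(B+k, k)], so a solution can be excluded by a modulus [p] for which [A!/k!]
    is not congruent to any [binomial(x+k, k)]. Seventeen primes suffice to exclude all pairs
    but the genuine representations [A! = 1 * 2 ... A = 2 * 3 ... A], [5! = 4*5*6],
    [6! = 8*9*10] and [7! = 7*8*9*10]. *)

(** * The sieve *)

Local Open Scope positive_scope.

(* Residues modulo [p] are represented in [1..p], with [p] standing for 0. *)
Definition reduce (p s : positive) : positive :=
  match (s ?= p) with Gt => s - p | _ => s end.

Definition add_mod (p a b : positive) : positive := reduce p (a + b).

(** Binary double-and-add: for [a <= p] every intermediate value stays at most [2p], while [b]
    itself may exceed [p]. *)
Fixpoint mul_mod (p a b : positive) : positive :=
  match b with
  | xH => a
  | xO b' => reduce p (xO (mul_mod p a b'))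
  | xI b' => add_mod p (reduce p (xO (mul_mod p a b'))) a
  end.

(** Sets of positives branching on binary digits from the lowest, so that a lookup costs at most the
    length of the key. *)
Inductive trie := Leaf | Node (b : bool) (l r : trie).

Fixpoint insert (n : positive) (t : trie) : trie :=
  match t with
  | Leaf => match n with
            | xH => Node true Leaf Leaf
            | xO n' => Node false (insert n' Leaf) Leaf
            | xI n' => Node false Leaf (insert n' Leaf)
            end
  | Node b l r => match n with
                  | xH => Node true l r
                  | xO n' => Node b (insert n' l) r
                  | xI n' => Node b l (insert n' r)
                  end
  end.

Fixpoint mem (n : positive) (t : trie) : bool :=
  match t with
  | Leaf => false
  | Node b l r => match n with xH => b | xO n' => mem n' l | xI n' => mem n' r end
  end.

Definition trie_of (l : list positive) : trie :=
  fold_left (fun t n => insert n t) l Leaf.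

Fixpoint partial_sums (p acc : positive) (row : list positive) : list positive :=
  match row with
  | nil => nil
  | v :: row' => let a := add_mod p acc v in a :: partial_sums p a row'
  end.

(* The pairs [(k, 12!/k!)]. *)
Definition cofactors : list (positive * positive) :=
  [(2, 239500800); (3, 79833600); (4, 19958400); (5, 3991680); (6, 665280);
   (7, 95040); (8, 11880); (9, 1320); (10, 132); (11, 12); (12, 1)].

(* For one [k]: its parity, the inverse of [k!] modulo [p], and the values of [binomial(x+k, k)]. *)
Definition entry := (bool * positive * trie)%type.

Definition is_odd (k : positive) : bool := match k with xO _ => false | _ => true end.

(* [row] lists [binomial(x+k-1, k-1)] modulo [p]; by Pascal's rule its partial sums are the next row. *)
Fixpoint tables (p u : positive) (ks : list (positive * positive)) (row : list positive)
  : list entry :=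
  match ks with
  | nil => nil
  | (k, w) :: ks' =>
      let row' := partial_sums p p row in
      (is_odd k, mul_mod p u w, trie_of row') :: tables p u ks' row'
  end.

(** As [c] inverts [k!], [t] represents [A!/k!]. The table covers only half of the residues. The
    reflection [x -> -x-k-1] supplies the others: it preserves the value for even [k] and negates it
    for odd [k], whence the second lookup at [p - t]. A zero residue excludes nothing, since the
    product vanishes at [x = -1]. *)
Definition excluded (p f : positive) (e : entry) : bool :=
  let '(o, c, s) := e in
  let t := mul_mod p f c in
  if Pos.eqb t p then false
  else if mem t s then false
  else if o then negb (mem (p - t) s) else true.

(* The flag at position [j] tells whether [k = j + 2] is still possible; an exhausted list becomes [nil]. *)
Fixpoint filter_flags (p f : positive) (es : list entry) (flags : list bool) : list bool :=
  match flags, es with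
  | b :: flags', e :: es' =>
      let rest := filter_flags p f es' flags' in
      if (if b then negb (excluded p f e) else false) then true :: rest
      else match rest with nil => nil | _ => false :: rest end
  | _, _ => nil
  end.

(** [f] enters as [(A-1)!] modulo [p], so each row costs one multiplication to update the
    factorial. *)
Fixpoint walk (p : positive) (es : list entry) (A f : positive) (alive : list (list bool))
  : list (list bool) :=
  match alive with
  | nil => nil
  | flags :: alive' =>
      let f' := mul_mod p f A in
      filter_flags p f' es flags :: walk p es (Pos.succ A) f' alive'
  end.

(** The test certifies that [u] inverts [12! = 479001600], hence that each [k!] with [k <= 12] is
    invertible. The row of ones is long enough to reach all [x] with [2x <= p - 1]. *)
Definition sieve_by (alive : list (list bool)) (pu : positive * positive) : list (list bool) :=
  let (p, u) := pu in
  if Pos.eqb (mul_mod p u 479001600) 1 then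
    walk p (tables p u cofactors (partial_sums p p (repeat 1 (Pos.to_nat (Pos.succ (Pos.div2 p)))))) 1 1 alive
  else alive.

(** Here [A! = (B+1)...(B+k)] has a genuine solution, namely [B = 0, 1, 3, 7, 6] in this order, so
    no modulus can exclude the pair. For [k <= 12] the cases [k = A] and [k + 1 = A] satisfy
    [A <= 13]. *)
Definition exceptional (A k : positive) : bool :=
  (Pos.leb A 13) &&
  (Pos.eqb k A || Pos.eqb (Pos.succ k) A || (Pos.eqb A 5 && Pos.eqb k 3)
   || (Pos.eqb A 6 && Pos.eqb k 3) || (Pos.eqb A 7 && Pos.eqb k 4)).

Fixpoint candidates (n : nat) (A : positive) : list (list bool) :=
  match n with
  | O => nil
  | S n' => map (fun kw => negb (exceptional A (fst kw))) cofactors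
            :: candidates n' (Pos.succ A)
  end.

(* Pairs of a prime [p > 9999] and the inverse of 12! modulo [p]. *)
Definition moduli1 : list (positive * positive) :=
  [(10009, 9016); (10039, 9573)].

Definition moduli2 : list (positive * positive) :=
  [(10007, 5729); (10103, 3032); (10067, 5742)].

Definition moduli3 : list (positive * positive) :=
  [(10163, 1986); (10343, 2613); (10369, 2004); (11083, 5144)].

Definition moduli4 : list (positive * positive) :=
  [(11239, 6525); (11587, 8895); (14767, 8925); (13499, 8566)].

Definition moduli5 : list (positive * positive) :=
  [(11717, 11086); (14593, 9995); (13751, 6276); (10223, 3511)].

(** The flags left after each batch of primes are stored as a literal, which splits the computation
    into separately checked stages. *)
Definition survivors1 : list (list bool) :=
  Eval vm_compute in fold_left sieve_by moduli1 (candidates (Pos.to_nat 9999) 1).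

Lemma survivors1_eq : fold_left sieve_by moduli1 (candidates (Pos.to_nat 9999) 1) = survivors1.
Proof. vm_cast_no_check (eq_refl survivors1). Qed.

Definition survivors2 : list (list bool) :=
  Eval vm_compute in fold_left sieve_by moduli2 (survivors1).

Lemma survivors2_eq : fold_left sieve_by moduli2 (survivors1) = survivors2.
Proof. vm_cast_no_check (eq_refl survivors2). Qed.

Definition survivors3 : list (list bool) :=
  Eval vm_compute in fold_left sieve_by moduli3 (survivors2).

Lemma survivors3_eq : fold_left sieve_by moduli3 (survivors2) = survivors3.
Proof. vm_cast_no_check (eq_refl survivors3). Qed.

Definition survivors4 : list (list bool) :=
  Eval vm_compute in fold_left sieve_by moduli4 (survivors3).

Lemma survivors4_eq : fold_left sieve_by moduli4 (survivors3) = survivors4.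
Proof. vm_cast_no_check (eq_refl survivors4). Qed.

Lemma no_survivor :
  forallb (fun flags => match flags with nil => true | _ => false end)
    (fold_left sieve_by moduli5 survivors4) = true.
Proof. vm_cast_no_check (eq_refl true). Qed.

Close Scope positive_scope.

(** * Rising products and their residues *)

Local Open Scope Z_scope.

(** The product [(x+1)...(x+k)], that is [k!] times [binomial(x+k, k)], also for negative [x]. *)
Fixpoint rise (k : nat) (x : Z) : Z :=
  match k with O => 1 | S k' => rise k' x * (x + Z.of_nat k) end.

(** A factorial in binary, fit for evaluation, unlike the unary [fact]. *)
Fixpoint factZ (n : nat) : Z :=
  match n with O => 1 | S n' => Z.of_nat n * factZ n' end.

Lemma factZ_succ n : factZ (S n) = Z.of_nat (S n) * factZ n.
Proof. reflexivity. Qed.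

Lemma factZ_fact n : factZ n = Z.of_nat (fact n).
Proof.
  induction n as [|n IH]; [reflexivity|].
  rewrite factZ_succ, IH, <- Nat2Z.inj_mul. reflexivity.
Qed.

Lemma factZ_add B k : factZ (B + k) = factZ B * rise k (Z.of_nat B).
Proof.
  induction k as [|k IH].
  - rewrite Nat.add_0_r. simpl. lia.
  - rewrite Nat.add_succ_r, factZ_succ, IH. cbn [rise]. replace (Z.of_nat (S (B + k))) with (Z.of_nat B + Z.of_nat (S k)) by lia. ring.
Qed.

Lemma rise_pred k x : rise (S k) (x - 1) = x * rise k x.
Proof.
  induction k as [|k IH].
  - cbn [rise]. lia.
  - cbn [rise] in *. rewrite IH. replace (x - 1 + Z.of_nat (S (S k))) with (x + Z.of_nat (S k)) by lia. ring.
Qed.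

Lemma rise_pascal k x : rise (S k) x = rise (S k) (x - 1) + Z.of_nat (S k) * rise k x.
Proof. rewrite rise_pred. cbn [rise]. ring. Qed.

(** The reflection turns the factor [x + i] into [-(x + k + 1 - i)], reversing the order of the
    factors and changing [k] signs. *)
Lemma rise_opp k x : rise k (- x - Z.of_nat k - 1) = (if Nat.odd k then -1 else 1) * rise k x.
Proof.
  induction k as [|k IH].
  - reflexivity.
  - cbn [rise]. 
    replace (- x - Z.of_nat (S k) - 1) with ((- x - Z.of_nat k - 1) - 1) by lia.
    pose proof (rise_pred k (- x - Z.of_nat k - 1)) as H. cbn [rise] in H. rewrite H, IH.
    rewrite Nat.odd_succ, <- Nat.negb_odd. destruct (Nat.odd k); cbn [negb]; lia.
Qed.

Definition cong (p a b : Z) : Prop := exists t, a = b + t * p.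

Lemma cong_refl p a : cong p a a.
Proof. exists 0. ring. Qed.
Lemma cong_sym p a b : cong p a b -> cong p b a.
Proof. intros [t ->]. exists (-t). ring. Qed.
Lemma cong_trans p a b c : cong p a b -> cong p b c -> cong p a c.
Proof. intros [t ->] [s ->]. exists (t + s). ring. Qed.
Lemma cong_add p a b c d : cong p a b -> cong p c d -> cong p (a + c) (b + d).
Proof. intros [t ->] [s ->]. exists (t + s). ring. Qed.
Lemma cong_mul p a b c d : cong p a b -> cong p c d -> cong p (a * c) (b * d).
Proof. intros [t ->] [s ->]. exists (t * d + b * s + t * s * p). ring. Qed.

Lemma cong_rise p k x y : cong p x y -> cong p (rise k x) (rise k y).
Proof.
  intros H. induction k as [|k IH]; cbn [rise].
  - apply cong_refl.
  - apply cong_mul; [exact IH|]. apply cong_add; [exact H|apply cong_refl].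
Qed.

Lemma cong_unique p a b : 1 <= a <= p -> 1 <= b <= p -> cong p a b -> a = b.
Proof. intros Ha Hb [t Ht]. assert (t = 0) by nia. subst. lia. Qed.

Lemma rise_zero k x : - Z.of_nat k <= x <= -1 -> rise k x = 0.
Proof.
  induction k as [|k IH]; intros H; [lia|]. cbn [rise].
  destruct (Z.eq_dec x (- Z.of_nat (S k))) as [->|]; [|rewrite IH by lia; ring].
  rewrite Z.add_opp_diag_l. ring.
Qed.

(* The symmetry [x -> -x-k-1] of the product confines [x] to half of the residues. *)
Lemma rise_residues (p : Z) (k : nat) (B : Z) : 0 < p ->
  cong p (rise k B) 0 \/
  exists x, 0 <= 2 * x <= p - 1 /\
    (cong p (rise k B) (rise k x) \/
     cong p (rise k B) ((if Nat.odd k then -1 else 1) * rise k x)).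
Proof.
  intros Hp. pose proof (Z.mod_pos_bound B p Hp) as Hx.
  assert (HB : cong p B (B mod p)) by (exists (B / p); rewrite (Z.div_mod B p) at 1; lia).
  set (x := B mod p) in *.
  destruct (Z_le_gt_dec (2 * x) (p - 1)).
  - right. exists x. split; [lia|]. left. now apply cong_rise.
  - assert (HB' : cong p B (x - p)).
    { apply (cong_trans _ _ _ _ HB). exists 1. ring. }
    (* The representative [x - p] is negative: either some factor vanishes there, or its reflection
       [p - x - k - 1] is nonnegative and lies in the lower half. *)
    destruct (Z_le_gt_dec (- Z.of_nat k) (x - p)).
    + left. rewrite <- (rise_zero k (x - p)) by lia. now apply cong_rise.
    + right. exists (p - x - Z.of_nat k - 1). split; [lia|]. right.
      rewrite <- rise_opp. apply cong_rise.
      replace (- (p - x - Z.of_nat k - 1) - Z.of_nat k - 1) with (x - p) by ring. exact HB'.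
Qed.

(** * Correctness of the sieve *)

Lemma reduce_spec p s : Zpos s <= 2 * Zpos p -> cong (Zpos p) (Zpos (reduce p s)) (Zpos s) /\ Zpos (reduce p s) <= Zpos p.
Proof.
  intros H. unfold reduce. destruct (Pos.compare_spec s p) as [->|Hl|Hl].
  - split; [apply cong_refl|lia].
  - split; [apply cong_refl|lia].
  - rewrite Pos2Z.inj_sub by exact Hl. split; [exists (-1); ring|lia].
Qed.

Lemma add_mod_spec p a b : Zpos a <= Zpos p -> Zpos b <= Zpos p ->
  cong (Zpos p) (Zpos (add_mod p a b)) (Zpos a + Zpos b) /\ Zpos (add_mod p a b) <= Zpos p.
Proof. intros Ha Hb. unfold add_mod. apply reduce_spec. lia. Qed.

Lemma mul_mod_spec p a b : Zpos a <= Zpos p ->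
  cong (Zpos p) (Zpos (mul_mod p a b)) (Zpos a * Zpos b) /\ Zpos (mul_mod p a b) <= Zpos p.
Proof.
  intros Ha. induction b as [b [IH1 IH2]|b [IH1 IH2]|]; cbn [mul_mod].
  - destruct (reduce_spec p (xO (mul_mod p a b))) as [H1 H2]; [lia|].
    destruct (add_mod_spec p (reduce p (xO (mul_mod p a b))) a) as [H3 H4]; [lia|lia|].
    split; [|exact H4]. apply (cong_trans _ _ _ _ H3).
    replace (Zpos a * Zpos (xI b)) with (2 * (Zpos a * Zpos b) + Zpos a) by lia.
    apply cong_add; [|apply cong_refl]. apply (cong_trans _ _ _ _ H1).
    rewrite Pos2Z.inj_xO. apply cong_mul; [apply cong_refl|exact IH1].
  - destruct (reduce_spec p (xO (mul_mod p a b))) as [H1 H2]; [lia|].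
    split; [|exact H2]. apply (cong_trans _ _ _ _ H1).
    replace (Zpos a * Zpos (xO b)) with (2 * (Zpos a * Zpos b)) by lia.
    rewrite Pos2Z.inj_xO. apply cong_mul; [apply cong_refl|exact IH1].
  - split; [|exact Ha]. rewrite Z.mul_1_r. apply cong_refl.
Qed.

Lemma mem_insert_same n t : mem n (insert n t) = true.
Proof. revert t. induction n; intros [|b l r]; simpl; auto. Qed.

Lemma mem_insert n m t : mem n t = true -> mem n (insert m t) = true.
Proof.
  revert m t. induction n as [n IH|n IH|]; intros [m|m|] [|b l r]; simpl; auto; discriminate.
Qed.

Lemma mem_trie_of n l : In n l -> mem n (trie_of l) = true.
Proof.
  unfold trie_of.
  assert (H : forall l t, In n l \/ mem n t = true ->
            mem n (fold_left (fun t n => insert n t) l t) = true).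
  { clear l. induction l as [|m l IH]; intros t Hor; cbn [fold_left].
    - now destruct Hor.
    - apply IH. destruct Hor as [Hin|Hm]; [|right; now apply mem_insert].
      destruct Hin as [->|Hin]; [right; apply mem_insert_same|now left]. }
  auto.
Qed.

(** Binomial coefficients are described through their multiples by [k!], which avoids division. *)
Fixpoint row_ok (p : positive) (k : nat) (x : Z) (row : list positive) : Prop :=
  match row with
  | nil => True
  | v :: row' =>
      (Zpos v <= Zpos p /\ cong (Zpos p) (factZ k * Zpos v) (rise k x)) /\ row_ok p k (x + 1) row'
  end.

Lemma row_ok_repeat p n x : row_ok p 0 x (repeat 1%positive n).
Proof.
  revert x. induction n as [|n IH]; intros x; simpl; [exact I|].
  split; [split; [lia|apply cong_refl]|apply IH].
Qed.

(** The accumulator is the new entry at [x - 1]; by [rise_pascal], adding the old entry at [x] gives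
    the new one at [x]. *)
Lemma partial_sums_ok p k row : forall x acc,
  Zpos acc <= Zpos p ->
  cong (Zpos p) (factZ (S k) * Zpos acc) (rise (S k) (x - 1)) ->
  row_ok p k x row -> row_ok p (S k) x (partial_sums p acc row).
Proof.
  induction row as [|v row IH]; intros x acc Hacc Hc Hrow; cbn [partial_sums row_ok]; [exact I|].
  destruct Hrow as [[Hv Hr] Hrow].
  destruct (add_mod_spec p acc v Hacc Hv) as [H1 H2].
  assert (H3 : cong (Zpos p) (factZ (S k) * Zpos (add_mod p acc v)) (rise (S k) x)).
  { rewrite rise_pascal.
    apply (cong_trans _ _ (factZ (S k) * (Zpos acc + Zpos v))).
    - apply cong_mul; [apply cong_refl|exact H1].
    - rewrite Z.mul_add_distr_l. apply cong_add; [exact Hc|].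
      rewrite factZ_succ, <- Z.mul_assoc. apply cong_mul; [apply cong_refl|exact Hr]. }
  split; [now split|]. apply IH; auto.
  replace (x + 1 - 1) with x by ring. exact H3.
Qed.

Lemma partial_sums_from_zero p k row :
  row_ok p k 0 row -> row_ok p (S k) 0 (partial_sums p p row).
Proof.
  (* The initial accumulator [p] stands for 0, the value of [rise (S k)] at [-1]. *)
  apply partial_sums_ok; [lia|]. rewrite rise_pred. exists (factZ (S k)). ring.
Qed.

Lemma partial_sums_length p row acc : length (partial_sums p acc row) = length row.
Proof. revert acc. induction row; intros; simpl; auto. Qed.

Lemma row_ok_In p k row : forall x0 x, row_ok p k x0 row ->
  x0 <= x < x0 + Z.of_nat (length row) ->
  exists v, In v row /\ Zpos v <= Zpos p /\ cong (Zpos p) (factZ k * Zpos v) (rise k x).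
Proof.
  induction row as [|v row IH]; intros x0 x Hrow Hx; cbn [length] in Hx; [lia|].
  destruct Hrow as [[Hv Hc] Hrow].
  destruct (Z.eq_dec x x0) as [->|Hne].
  - exists v. simpl. auto.
  - destruct (IH (x0 + 1) x Hrow) as (w & Hin & Hw); [lia|]. exists w. simpl. auto.
Qed.

Definition entry_ok (p : positive) (k : nat) (e : entry) : Prop :=
  let '(o, c, s) := e in
  o = Nat.odd k /\ cong (Zpos p) (factZ k * Zpos c) 1 /\
  forall x, 0 <= 2 * x <= Zpos p - 1 ->
    exists v, mem v s = true /\ Zpos v <= Zpos p /\ cong (Zpos p) (factZ k * Zpos v) (rise k x).

Fixpoint entries_ok (p : positive) (k : nat) (es : list entry) : Prop :=
  match es with nil => True | e :: es' => entry_ok p k e /\ entries_ok p (S k) es' end.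

Fixpoint cofactors_ok (M : Z) (k : nat) (ks : list (positive * positive)) : Prop :=
  match ks with
  | nil => True
  | (j, w) :: ks' => (is_odd j = Nat.odd k /\ factZ k * Zpos w = M) /\ cofactors_ok M (S k) ks'
  end.

(** From [k! * w = M] and [u * M = 1] modulo [p], [u * w] inverts [k!]: one inverse per modulus
    serves every [k]. *)
Lemma tables_ok p u M ks : forall k row,
  Zpos u <= Zpos p -> cong (Zpos p) (Zpos u * M) 1 ->
  cofactors_ok M (S k) ks -> row_ok p k 0 row -> Zpos p <= 2 * Z.of_nat (length row) ->
  entries_ok p (S k) (tables p u ks row).
Proof.
  induction ks as [|[j w] ks IH]; intros k row Hu HM Hks Hrow Hlen; cbn [tables entries_ok]; [exact I|].
  destruct Hks as [[Hodd Hw] Hks].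
  assert (Hrow' := partial_sums_from_zero p k row Hrow).
  split.
  - split; [exact Hodd|split].
    + apply (cong_trans _ _ (Zpos u * M)); [|exact HM].
      replace (Zpos u * M) with (factZ (S k) * (Zpos u * Zpos w)) by (rewrite <- Hw; ring).
      apply cong_mul; [apply cong_refl|]. now apply mul_mod_spec.
    + intros x Hx.
      destruct (row_ok_In p (S k) _ 0 x Hrow') as (v & Hin & Hv);
        [rewrite partial_sums_length; lia|].
      exists v. split; [now apply mem_trie_of|exact Hv].
  - apply IH; auto. now rewrite partial_sums_length.
Qed.

(** Cancelling [k!] shows that [t] is congruent to a tabulated value or, for odd [k], to the
    opposite of one. Representatives in [1..p] are unique, so the corresponding lookup succeeds. *)
Lemma excluded_sound p k e A f B :
  entry_ok p k e -> Zpos f <= Zpos p -> cong (Zpos p) (Zpos f) (factZ A) ->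
  factZ A = rise k B -> excluded p f e = false.
Proof.
  destruct e as [[o c] s]. intros (Ho & Hc & Hs) Hf Hcf HAB. cbn [excluded].
  destruct (mul_mod_spec p f c Hf) as [Ht Htp]. set (t := mul_mod p f c) in *.
  assert (Ht' : forall g, cong (Zpos p) (factZ A) (factZ k * g) -> cong (Zpos p) (Zpos t) g).
  { intros g Hg. apply (cong_trans _ _ _ _ Ht).
    apply (cong_trans _ _ (factZ k * g * Zpos c)).
    - apply cong_mul; [|apply cong_refl]. exact (cong_trans _ _ _ _ Hcf Hg).
    - replace (factZ k * g * Zpos c) with (factZ k * Zpos c * g) by ring.
      rewrite <- (Z.mul_1_l g) at 2. apply cong_mul; [exact Hc|apply cong_refl]. }
  destruct (Pos.eqb_spec t p) as [_|Htne]; [reflexivity|].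
  assert (Htlt : (t < p)%positive) by lia.
  rewrite HAB in Ht'.
  destruct (rise_residues (Zpos p) k B) as [H0|(x & Hx & Hcase)]; [lia| |].
  - exfalso. apply Htne. apply Pos2Z.inj. apply (cong_unique (Zpos p)); [lia|lia|].
    apply Ht'. apply (cong_trans _ _ _ _ H0). exists (- factZ k). ring.
  - destruct (Hs x Hx) as (v & Hmem & Hvp & Hv).
    assert (Hpos : cong (Zpos p) (rise k B) (rise k x) -> mem t s = true).
    { intros H. replace t with v; [exact Hmem|]. symmetry. apply Pos2Z.inj.
      apply (cong_unique (Zpos p)); [lia|lia|].
      apply Ht'. apply (cong_trans _ _ _ _ H). now apply cong_sym. }
    destruct (mem t s) eqn:Ems; [reflexivity|].
    destruct Hcase as [H|H]; [discriminate (Hpos H)|].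
    subst o. destruct (Nat.odd k).
    + replace (p - t)%positive with v; [now rewrite Hmem|].
      apply Pos2Z.inj. rewrite Pos2Z.inj_sub by exact Htlt.
      apply (cong_unique (Zpos p)); [lia|lia|].
      assert (H2 : cong (Zpos p) (Zpos t) (- Zpos v)).
      { apply Ht'. apply (cong_trans _ _ _ _ H).
        replace (factZ k * - Zpos v) with (-1 * (factZ k * Zpos v)) by ring.
        apply cong_mul; [apply cong_refl|now apply cong_sym]. }
      destruct H2 as [q Hq]. exists (q - 1). rewrite Hq. ring.
    + rewrite Z.mul_1_l in H. discriminate (Hpos H).
Qed.

Definition solvable (A k : nat) : Prop :=
  exceptional (Pos.of_nat A) (Pos.of_nat k) = false /\
  exists B : Z, factZ A = rise k B.

(** With the default [false], positions cut off by [filter_flags] count as excluded. *)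
Definition flags_ok (A k n : nat) (flags : list bool) : Prop :=
  forall j, (j < n)%nat -> solvable A (k + j) -> nth j flags false = true.

Lemma filter_flags_ok p A f es : forall k flags,
  entries_ok p k es -> Zpos f <= Zpos p -> cong (Zpos p) (Zpos f) (factZ A) ->
  flags_ok A k (length es) flags -> flags_ok A k (length es) (filter_flags p f es flags).
Proof.
  induction es as [|e es IH]; intros k flags Hes Hf Hc Hflags; [intros j Hj; simpl in Hj; lia|].
  destruct Hes as [He Hes].
  destruct flags as [|b flags].
  { intros j Hj Hs. exact (Hflags j Hj Hs). }
  assert (Hrest : flags_ok A (S k) (length es) (filter_flags p f es flags)).
  { apply IH; auto. intros j Hj Hs. apply (Hflags (S j)); [simpl; lia|].
    now rewrite Nat.add_succ_r. }
  intros j Hj Hs. cbn [filter_flags]. cbn [length] in Hj.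
  destruct j as [|j].
  - pose proof (Hflags 0%nat Hj Hs) as Hb. cbn in Hb. subst b.
    rewrite Nat.add_0_r in Hs. destruct Hs as [_ [B HB]].
    rewrite (excluded_sound p k e A f B He Hf Hc HB). reflexivity.
  - specialize (Hrest j ltac:(lia)). rewrite Nat.add_succ_comm in Hrest. specialize (Hrest Hs).
    destruct (if b then _ else _); [exact Hrest|].
    destruct (filter_flags p f es flags); [destruct j|]; exact Hrest.
Qed.

Fixpoint alive_ok (A : nat) (alive : list (list bool)) : Prop :=
  match alive with
  | nil => True
  | flags :: alive' => flags_ok A 2 11 flags /\ alive_ok (S A) alive'
  end.

Lemma walk_ok p es : entries_ok p 2 es -> length es = 11%nat -> forall alive A f,
  Zpos f <= Zpos p -> cong (Zpos p) (Zpos f) (factZ A) ->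
  alive_ok (S A) alive -> alive_ok (S A) (walk p es (Pos.of_succ_nat A) f alive).
Proof.
  intros Hes Hlen. induction alive as [|flags alive IH]; intros A f Hf Hc Hal; [exact I|].
  destruct Hal as [Hfl Hal]. cbn [walk alive_ok].
  destruct (mul_mod_spec p f (Pos.of_succ_nat A) Hf) as [H1 H2].
  assert (H3 : cong (Zpos p) (Zpos (mul_mod p f (Pos.of_succ_nat A))) (factZ (S A))).
  { apply (cong_trans _ _ _ _ H1). rewrite factZ_succ, Z.mul_comm.
    apply cong_mul; [rewrite Zpos_P_of_succ_nat, Nat2Z.inj_succ; apply cong_refl|exact Hc]. }
  split.
  - rewrite <- Hlen. apply filter_flags_ok; auto. now rewrite Hlen.
  - apply (IH (S A)); auto.
Qed.

Lemma walk_length p es alive : forall A f, length (walk p es A f alive) = length alive.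
Proof. induction alive; intros; simpl; auto. Qed.

Lemma cofactors_correct : cofactors_ok 479001600 2 cofactors.
Proof. repeat split. Qed.

Lemma tables_length p u ks : forall row, length (tables p u ks row) = length ks.
Proof. induction ks as [|[j w] ks IH]; intros; simpl; auto. Qed.

Lemma sieve_by_ok alive pu : alive_ok 1 alive -> (Zpos (snd pu) <= Zpos (fst pu)) -> alive_ok 1 (sieve_by alive pu).
Proof.
  destruct pu as [p u]. cbn [fst snd sieve_by]. intros Hal Hu.
  destruct (Pos.eqb_spec (mul_mod p u 479001600) 1) as [H1|]; [|exact Hal].
  destruct (mul_mod_spec p u 479001600 Hu) as [H2 _]. rewrite H1 in H2.
  apply (walk_ok p _) with (A := O) (f := 1%positive); [| |lia|apply cong_refl|exact Hal].
  - apply (tables_ok p u 479001600 cofactors 1); auto.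
    + now apply cong_sym.
    + exact cofactors_correct.
    + apply partial_sums_from_zero, row_ok_repeat.
    + rewrite partial_sums_length, repeat_length, positive_nat_Z, Pos2Z.inj_succ.
      destruct p; cbn [Pos.div2]; lia.
  - apply tables_length.
Qed.

Lemma sieve_by_length alive pu : length (sieve_by alive pu) = length alive.
Proof. destruct pu as [p u]. cbn [sieve_by]. destruct (Pos.eqb _ _); [apply walk_length|reflexivity]. Qed.
Lemma candidates_ok n : forall A, alive_ok (S A) (candidates n (Pos.of_succ_nat A)).
Proof.
  induction n as [|n IH]; intros A; [exact I|]. cbn [candidates alive_ok]. split; [|apply (IH (S A))].
  intros j Hj [He _]. rewrite <- Pos.of_nat_succ in He.
  do 11 (destruct j as [|j]; [exact (f_equal negb He)|]). lia.
Qed.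

Lemma candidates_length n : forall A, length (candidates n A) = n.
Proof. induction n; intros; simpl; auto. Qed.

Lemma fold_sieve_ok ms : forall alive, alive_ok 1 alive ->
  forallb (fun pu => Pos.leb (snd pu) (fst pu)) ms = true ->
  alive_ok 1 (fold_left sieve_by ms alive).
Proof.
  induction ms as [|pu ms IH]; intros alive Hal Hms; [exact Hal|].
  apply andb_prop in Hms as [Hpu Hms]. apply Pos.leb_le in Hpu.
  apply IH; [now apply sieve_by_ok|exact Hms].
Qed.

Lemma fold_sieve_length ms : forall alive, length (fold_left sieve_by ms alive) = length alive.
Proof.
  induction ms as [|pu ms IH]; intros alive; [reflexivity|].
  cbn [fold_left]. now rewrite IH, sieve_by_length.
Qed.

Lemma alive_ok_nth alive : forall A i, alive_ok A alive -> (i < length alive)%nat ->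
  flags_ok (A + i) 2 11 (nth i alive nil).
Proof.
  induction alive as [|flags alive IH]; intros A i Hal Hi; [simpl in Hi; lia|].
  destruct Hal as [Hfl Hal]. destruct i as [|i].
  - now rewrite Nat.add_0_r.
  - rewrite Nat.add_succ_r. apply (IH (S A)); [exact Hal|simpl in Hi; lia].
Qed.

(** The flag of a solvable pair that is not exceptional would survive every stage, whereas all final
    rows are empty. *)
Lemma sieve_sound (A k : nat) (B : Z) :
  (1 <= A)%nat -> Z.of_nat A <= 9999 -> (2 <= k <= 12)%nat -> factZ A = rise k B ->
  exceptional (Pos.of_nat A) (Pos.of_nat k) = true.
Proof.
  intros HA HA' Hk HB.
  destruct (exceptional _ _) eqn:He; [reflexivity|exfalso].
  assert (Hok : alive_ok 1 (fold_left sieve_by moduli5 survivors4)).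
  { rewrite <- survivors4_eq, <- survivors3_eq, <- survivors2_eq, <- survivors1_eq.
    repeat (apply fold_sieve_ok; [|reflexivity]). exact (candidates_ok _ 0). }
  assert (Hlen : length (fold_left sieve_by moduli5 survivors4) = Pos.to_nat 9999).
  { rewrite <- survivors4_eq, <- survivors3_eq, <- survivors2_eq, <- survivors1_eq.
    rewrite !fold_sieve_length. apply candidates_length. }
  pose proof no_survivor as Hno.
  set (final := fold_left sieve_by moduli5 survivors4) in *. clearbody final.
  rewrite forallb_forall in Hno.
  (* Row [A] has index [A - 1], and the flag of [k] has position [k - 2]. *)
  pose proof (alive_ok_nth final 1 (A - 1) Hok) as Hfl. rewrite Hlen in Hfl.
  specialize (Hfl ltac:(lia) (k - 2)%nat ltac:(lia)).
  replace (1 + (A - 1))%nat with A in Hfl by lia. replace (2 + (k - 2))%nat with k in Hfl by lia.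
  specialize (Hfl (conj He (ex_intro _ B HB))).
  assert (Hin : In (nth (A - 1) final nil) final) by (apply nth_In; lia).
  specialize (Hno _ Hin). destruct (nth (A - 1) final nil); [destruct (k - 2)%nat|]; discriminate.
Qed.

(** * Integer bounds *)

Lemma factZ_pos n : 1 <= factZ n.
Proof. induction n as [|n IH]; [reflexivity|]. rewrite factZ_succ. nia. Qed.

Lemma rise_pos k x : 0 <= x -> 1 <= rise k x.
Proof. intros Hx. induction k as [|k IH]; cbn [rise]; [lia|]. nia. Qed.

Lemma rise_mono k x y : 0 <= x <= y -> rise k x <= rise k y.
Proof.
  intros Hxy. induction k as [|k IH]; cbn [rise]; [lia|].
  pose proof (rise_pos k x ltac:(lia)). apply Z.mul_le_mono_nonneg; lia.
Qed.

Lemma rise_strict k x y : 0 <= x < y -> (1 <= k)%nat -> rise k x < rise k y.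
Proof.
  intros Hxy Hk. destruct k as [|k]; [lia|]. cbn [rise].
  pose proof (rise_pos k x ltac:(lia)). pose proof (rise_mono k x y ltac:(lia)). nia.
Qed.

Lemma pow_le_rise k x : 0 <= x -> (x + 1) ^ Z.of_nat k <= rise k x.
Proof.
  intros Hx. induction k as [|k IH]; [reflexivity|]. cbn [rise].
  rewrite Nat2Z.inj_succ, Z.pow_succ_r, Z.mul_comm by lia.
  apply Z.mul_le_mono_nonneg; lia.
Qed.

(** * Powers of two in factorials and rising products *)

Lemma factZ_double n : exists o, factZ (2 * n) = 2 ^ Z.of_nat n * factZ n * o.
Proof.
  induction n as [|n [o IH]]; [exists 1; reflexivity|].
  exists (o * Z.of_nat (S (2 * n))).
  replace (2 * S n)%nat with (S (S (2 * n))) by lia.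
  rewrite !factZ_succ, IH, (Nat2Z.inj_succ n), Z.pow_succ_r by lia.
  replace (Z.of_nat (S (S (2 * n)))) with (2 * Z.succ (Z.of_nat n)) by lia. ring.
Qed.

(** Legendre's recursion: with [n = A/2], the exponent for [A] is [n] plus that for [n]. The factor
    [A + 1] is attained when [A + 1] is a power of 2. *)
Lemma fact_two_part A : exists v, 0 <= v /\ (2 ^ v | factZ A) /\ 2 ^ Z.of_nat A <= 2 ^ v * (Z.of_nat A + 1).
Proof.
  induction A as [A IH] using (well_founded_induction lt_wf).
  destruct (Nat.eq_dec A 0) as [->|HA].
  { exists 0. split; [lia|]. split; [apply Z.divide_1_l|]. cbn. lia. }
  pose proof (Nat.div_mod_eq A 2) as Hdm. pose proof (Nat.mod_upper_bound A 2 ltac:(lia)) as Hm.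
  set (n := (A / 2)%nat) in *.
  destruct (IH n ltac:(lia)) as (v & Hv & [q Hq] & Hle).
  destruct (factZ_double n) as [o Ho].
  exists (Z.of_nat n + v). split; [lia|].
  rewrite Z.pow_add_r by lia.
  assert (Hn2 : 0 < 2 ^ Z.of_nat n) by (apply Z.pow_pos_nonneg; lia).
  assert (Hv2 : 0 < 2 ^ v) by (apply Z.pow_pos_nonneg; lia).
  destruct (Nat.eq_dec (A mod 2) 0) as [E|E].
  - assert (HA2 : A = (2 * n)%nat) by lia. clearbody n. subst A. split.
    + exists (q * o). rewrite Ho, Hq. ring.
    + replace (Z.of_nat (2 * n)) with (Z.of_nat n + Z.of_nat n) by lia.
      rewrite Z.pow_add_r by lia. nia.
  - assert (HA2 : A = S (2 * n)) by lia. clearbody n. subst A. split.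
    + exists (Z.of_nat (S (2 * n)) * q * o). rewrite factZ_succ, Ho, Hq. ring.
    + replace (Z.of_nat (S (2 * n))) with (Z.succ (Z.of_nat n + Z.of_nat n)) by lia.
      rewrite Z.pow_succ_r, Z.pow_add_r by lia. nia.
Qed.

(** The even factors are the doubles of [B/2 + 1, ..., B/2 + k']; [o] is the product of the odd
    ones. *)
Lemma rise_halves k B : 0 <= B -> exists k' o,
  Z.of_nat k' = (B + Z.of_nat k) / 2 - B / 2 /\
  rise k B = 2 ^ Z.of_nat k' * rise k' (B / 2) * o /\ Z.odd o = true.
Proof.
  intros HB. induction k as [|k (k' & o & Hk' & Hr & Ho)].
  - exists O, 1. rewrite Z.add_0_r. split; [cbn; lia|]. split; reflexivity.
  - destruct (Z.odd (B + Z.of_nat (S k))) eqn:Hodd.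
    + exists k', (o * (B + Z.of_nat (S k))). split; [|split].
      * apply Z.odd_spec in Hodd as [q Hq]. rewrite Hk', Hq.
        replace (B + Z.of_nat k) with (q * 2) by lia.
        replace (2 * q + 1) with (1 + q * 2) by lia.
        rewrite Z.div_mul, Z.div_add by lia. reflexivity.
      * cbn [rise]. rewrite Hr. ring.
      * rewrite Z.odd_mul, Ho, Hodd. reflexivity.
    + exists (S k'), o.
      rewrite <- Z.negb_even in Hodd. apply negb_false_iff, Z.even_spec in Hodd as [q Hq].
      assert (Hdiv : (B + Z.of_nat k) / 2 = q - 1).
      { symmetry. apply (Z.div_unique _ _ _ 1); lia. }
      split; [|split; [|exact Ho]].
      * rewrite Hq, (Z.mul_comm 2 q), Z.div_mul by lia. lia.
      * cbn [rise]. rewrite Hr, Hq, Nat2Z.inj_succ, Z.pow_succ_r by lia.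
        replace (B / 2 + Z.succ (Z.of_nat k')) with q by lia. ring.
Qed.

Lemma odd_rel_prime_pow2 o e : 0 <= e -> Z.odd o = true -> rel_prime (2 ^ e) o.
Proof.
  intros He Ho. apply rel_prime_sym, rel_prime_Zpower_r; [exact He|].
  apply rel_prime_sym, prime_rel_prime; [exact prime_2|].
  intros [q Hq]. rewrite Hq, Z.odd_mul in Ho. rewrite andb_comm in Ho. discriminate.
Qed.

(* The even factors are twice consecutive integers, which gives the recursion. *)
Lemma rise_two_part k : forall B E, 0 <= B -> 0 <= E -> (2 ^ E | rise k B) ->
  (k = 1%nat -> 2 ^ E <= B + 1) /\
  ((2 <= k)%nat -> 4 * 2 ^ E <= 2 ^ Z.of_nat k * (B + Z.of_nat k)).
Proof.
  induction k as [k IH] using (well_founded_induction lt_wf).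
  intros B E HB HE Hdiv. split.
  - intros ->. apply Z.divide_pos_le; [lia|]. replace (B + 1) with (rise 1 B) by (cbn [rise]; lia). exact Hdiv.
  - intros Hk. destruct (rise_halves k B HB) as (k' & o & Hk' & Hr & Ho).
    assert (Hdm : B + Z.of_nat k = 2 * ((B + Z.of_nat k) / 2) + (B + Z.of_nat k) mod 2) by (apply Z.div_mod; lia).
    assert (Hdm' : B = 2 * (B / 2) + B mod 2) by (apply Z.div_mod; lia).
    pose proof (Z.mod_pos_bound (B + Z.of_nat k) 2 ltac:(lia)).
    pose proof (Z.mod_pos_bound B 2 ltac:(lia)).
    assert (HB2 : 0 <= B / 2) by lia.
    (* If [E <= k'], then [k' <= k - 1] and [B + k >= 2] suffice. Otherwise [2^k'] and the odd part
       [o] are cancelled, and induction applies to the halved factors. *)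
    destruct (Z_le_gt_dec E (Z.of_nat k')) as [Hle|Hgt].
    + apply (Z.le_trans _ (2 ^ Z.of_nat k * 2)); [|apply Z.mul_le_mono_nonneg_l; [apply Z.pow_nonneg|]; lia].
      replace (4 * 2 ^ E) with (2 ^ (E + 1) * 2) by (rewrite Z.pow_add_r by lia; ring).
      apply Z.mul_le_mono_nonneg_r; [lia|]. apply Z.pow_le_mono_r; lia.
    + assert (HE' : 2 ^ E = 2 ^ Z.of_nat k' * 2 ^ (E - Z.of_nat k')).
      { rewrite <- Z.pow_add_r by lia. f_equal. lia. }
      assert (Hpos : 0 < 2 ^ Z.of_nat k') by (apply Z.pow_pos_nonneg; lia).
      assert (Hd : (2 ^ (E - Z.of_nat k') | rise k' (B / 2))).
      { rewrite HE', Hr, <- Z.mul_assoc in Hdiv.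
        apply Z.mul_divide_cancel_l in Hdiv; [|lia].
        rewrite Z.mul_comm in Hdiv. apply (Gauss _ o _ Hdiv), odd_rel_prime_pow2; [lia|exact Ho]. }
      destruct (IH k' ltac:(lia) (B / 2) (E - Z.of_nat k') HB2 ltac:(lia) Hd) as [IH1 IH2].
      set (M := 2 ^ (E - Z.of_nat k')) in *.
      rewrite HE'.
      destruct (Nat.eq_dec k' 1) as [->|Hne].
      * specialize (IH1 eq_refl). change (2 ^ Z.of_nat 1) with 2.
        assert (2 ^ 2 <= 2 ^ Z.of_nat k) by (apply Z.pow_le_mono_r; lia).
        assert (2 * M <= B + Z.of_nat k) by lia. nia.
      * specialize (IH2 ltac:(lia)).
        (* At most half of [k + 1] factors are even: [2k' <= k + 1]. *)
        assert (H2k : 2 ^ Z.of_nat k' * 2 ^ Z.of_nat k' <= 2 * 2 ^ Z.of_nat k).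
        { rewrite <- Z.pow_add_r, <- Z.pow_succ_r by lia. apply Z.pow_le_mono_r; lia. }
        assert (Hh : 2 * (B / 2 + Z.of_nat k') <= B + Z.of_nat k) by lia.
        set (X := 2 ^ Z.of_nat k') in *. set (Y := 2 ^ Z.of_nat k) in *.
        set (Q := B / 2 + Z.of_nat k') in *.
        assert (0 <= Q) by lia.
        assert (4 * (X * M) <= X * X * Q) by nia.
        assert (X * X * Q <= 2 * Y * Q) by nia.
        nia.
Qed.

(** * Size bounds for [A], [k] and [B] *)

Lemma bernoulli a m : 0 <= a -> a ^ Z.of_nat m * (a + Z.of_nat m) <= a * (a + 1) ^ Z.of_nat m.
Proof.
  intros Ha. induction m as [|m IH]; [rewrite !Z.pow_0_r; lia|].
  rewrite Nat2Z.inj_succ, !Z.pow_succ_r by lia.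
  assert (0 <= a ^ Z.of_nat m) by (apply Z.pow_nonneg; lia).
  set (P := a ^ Z.of_nat m) in *. set (Q := (a + 1) ^ Z.of_nat m) in *. nia.
Qed.

(** This is [n! <= ((n+1)/2)^n]. The inductive step needs [2 (n+1)^(n+1) <= (n+2)^(n+1)], which is
    Bernoulli's inequality with [a = m = n + 1]. *)
Lemma fact_am_gm n : 2 ^ Z.of_nat n * factZ n <= (Z.of_nat n + 1) ^ Z.of_nat n.
Proof.
  induction n as [|n IH]; [reflexivity|].
  rewrite factZ_succ.
  assert (Hn : 0 <= Z.of_nat n) by lia.
  pose proof (bernoulli (Z.of_nat (S n)) (S n) ltac:(lia)) as H.
  rewrite (Nat2Z.inj_succ n) in *. set (a := Z.of_nat n) in *. clearbody a.
  unfold Z.succ in *. rewrite !(Z.pow_add_r _ a 1), !Z.pow_1_r in * by lia.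
  set (P := (a + 1) ^ a) in *. set (Q := (a + 1 + 1) ^ a) in *.
  assert (2 * (a + 1) * P <= (a + 1 + 1) * Q).
  { apply (Z.mul_le_mono_pos_l _ _ (a + 1)); lia. }
  replace (2 ^ a * 2 * ((a + 1) * factZ n)) with (2 * (a + 1) * (2 ^ a * factZ n)) by ring.
  nia.
Qed.

(** The equation divided by [B!], with [k = C - B]. *)
Definition factorial_product (A k : nat) (B : Z) : Prop :=
  (1 <= A)%nat /\ (2 <= k)%nat /\ Z.of_nat A <= B /\ factZ A = rise k B.

Lemma two_part_bound A k B : factorial_product A k B ->
  4 * 2 ^ Z.of_nat A <= (Z.of_nat A + 1) * 2 ^ Z.of_nat k * (B + Z.of_nat k).
Proof.
  intros (HA & Hk & HAB & Heq).
  destruct (fact_two_part A) as (v & Hv & Hdiv & Hle). rewrite Heq in Hdiv.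
  destruct (rise_two_part k B v ltac:(lia) Hv Hdiv) as [_ H]. specialize (H Hk).
  set (X := 2 ^ Z.of_nat k) in *. nia.
Qed.

Lemma fact_le_pow n : factZ n <= Z.of_nat n ^ Z.of_nat n.
Proof.
  assert (H : forall m : nat, (m <= n)%nat -> factZ m <= Z.of_nat n ^ Z.of_nat m).
  { induction m as [|m IH]; intros Hm; [reflexivity|].
    rewrite factZ_succ, (Nat2Z.inj_succ m), Z.pow_succ_r by lia.
    pose proof (factZ_pos m). apply Z.mul_le_mono_nonneg; lia. }
  now apply H.
Qed.

(** Otherwise [A^A < (B+1)^A <= (B+1)^k <= A! <= A^A]. *)
Lemma factors_fewer A k B : factorial_product A k B -> (k < A)%nat.
Proof.
  intros (HA & Hk & HAB & Heq). apply Nat.nle_gt. intros Hle.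
  pose proof (pow_le_rise k B ltac:(lia)) as H1.
  pose proof (fact_le_pow A) as H2.
  assert (H3 : (B + 1) ^ Z.of_nat A <= (B + 1) ^ Z.of_nat k) by (apply Z.pow_le_mono_r; lia).
  assert (H4 : Z.of_nat A ^ Z.of_nat A < (B + 1) ^ Z.of_nat A) by (apply Z.pow_lt_mono_l; lia).
  lia.
Qed.

(** From [(A+1)^k <= A! <= ((A+1)/2)^A] follows [2^A <= (A+1)^(A-k) <= 2^(m(A-k))]. *)
Lemma cofactor_bound A k B m : factorial_product A k B -> Z.of_nat A + 1 <= 2 ^ m -> 0 <= m ->
  Z.of_nat A <= m * (Z.of_nat A - Z.of_nat k).
Proof.
  intros Hf HAm Hm. pose proof (factors_fewer _ _ _ Hf) as HkA.
  destruct Hf as (HA & Hk & HAB & Heq).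
  pose proof (pow_le_rise k B ltac:(lia)) as H1.
  pose proof (fact_am_gm A) as H2.
  assert (H3 : (Z.of_nat A + 1) ^ Z.of_nat k <= factZ A).
  { rewrite Heq. apply (Z.le_trans _ ((B + 1) ^ Z.of_nat k)); [apply Z.pow_le_mono_l; lia|exact H1]. }
  set (a := Z.of_nat A) in *. set (j := Z.of_nat k) in *.
  assert (H4 : (a + 1) ^ a = (a + 1) ^ j * (a + 1) ^ (a - j)).
  { rewrite <- Z.pow_add_r by lia. f_equal. lia. }
  assert (Hp : 0 < (a + 1) ^ j) by (apply Z.pow_pos_nonneg; lia).
  assert (H5 : 2 ^ a <= (a + 1) ^ (a - j)).
  { apply (Z.mul_le_mono_pos_r _ _ ((a + 1) ^ j)); [exact Hp|].
    rewrite (Z.mul_comm ((a + 1) ^ (a - j))), <- H4.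
    apply (Z.le_trans _ (2 ^ a * factZ A)); [|exact H2].
    apply Z.mul_le_mono_nonneg_l; [apply Z.pow_nonneg; lia|exact H3]. }
  assert (H6 : (a + 1) ^ (a - j) <= 2 ^ (m * (a - j))).
  { rewrite Z.pow_mul_r by lia. apply Z.pow_le_mono_l. lia. }
  assert (He : 0 <= m * (a - j)) by (apply Z.mul_nonneg_nonneg; lia).
  clear - H5 H6 He. apply (Z.pow_le_mono_r_iff 2); [lia|exact He|].
  exact (Z.le_trans _ _ _ H5 H6).
Qed.

(** In [two_part_bound], [A + 1] is replaced by [2^m] and [B + k] by [2B]. *)
Lemma base_lower_bound A k B m : factorial_product A k B -> Z.of_nat A + 1 <= 2 ^ m -> 0 <= m ->
  0 <= Z.of_nat A + 1 - m - Z.of_nat k -> 2 ^ (Z.of_nat A + 1 - m - Z.of_nat k) <= B.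
Proof.
  intros Hf HAm Hm He. pose proof (two_part_bound _ _ _ Hf) as H.
  pose proof (factors_fewer _ _ _ Hf) as HkA. destruct Hf as (HA & Hk & HAB & _).
  set (e := Z.of_nat A + 1 - m - Z.of_nat k) in *.
  replace (Z.of_nat A) with (e + m + Z.of_nat k - 1) in H at 1 by lia.
  assert (Hx : 4 * 2 ^ (e + m + Z.of_nat k - 1) = 2 * 2 ^ e * 2 ^ m * 2 ^ Z.of_nat k).
  { rewrite <- (Z.pow_succ_r 2 e), <- !Z.pow_add_r by lia.
    change 4 with (2 ^ 2). rewrite <- Z.pow_add_r by lia. f_equal. lia. }
  rewrite Hx in H.
  assert (Hm2 : 0 < 2 ^ m) by (apply Z.pow_pos_nonneg; lia).
  assert (Hk2 : 0 < 2 ^ Z.of_nat k) by (apply Z.pow_pos_nonneg; lia).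
  assert (H2 : (Z.of_nat A + 1) * 2 ^ Z.of_nat k * (B + Z.of_nat k) <= 2 ^ m * 2 ^ Z.of_nat k * (2 * B)).
  { apply Z.mul_le_mono_nonneg; [nia|nia|lia|lia]. }
  apply (Z.mul_le_mono_pos_r _ _ (2 * 2 ^ m * 2 ^ Z.of_nat k)); nia.
Qed.

Lemma pow_base_le_fact A k B m : factorial_product A k B -> Z.of_nat A + 1 <= 2 ^ m -> 0 <= m ->
  0 <= Z.of_nat A + 1 - m - Z.of_nat k ->
  2 ^ (Z.of_nat k * (Z.of_nat A + 1 - m - Z.of_nat k)) <= factZ A.
Proof.
  intros Hf HAm Hm He. pose proof (base_lower_bound _ _ _ _ Hf HAm Hm He) as H.
  destruct Hf as (HA & Hk & HAB & Heq). rewrite Heq, Z.mul_comm, Z.pow_mul_r by lia.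
  apply (Z.le_trans _ ((B + 1) ^ Z.of_nat k)); [|apply pow_le_rise; lia].
  apply Z.pow_le_mono_l. split; [apply Z.pow_nonneg|]; lia.
Qed.

(** At [m = 8] this reads [120 < 128], and it fails at [m = 7]; hence the separate treatment of
    [A <= 127]. *)
Lemma pow2_gt_quadratic m : 8 <= m -> 2 * m * m - m < 2 ^ (m - 1).
Proof.
  intros Hm. pattern m. apply Zlt_lower_bound_ind with (z := 8); [|exact Hm].
  intros x IH Hx. destruct (Z.eq_dec x 8) as [->|Hne]; [reflexivity|].
  specialize (IH (x - 1) ltac:(lia)). replace (x - 1) with (Z.succ (x - 1 - 1)) by lia.
  rewrite Z.pow_succ_r by lia. nia.
Qed.

(* As a quadratic in [k], [k (A+1-m-k) - A (m-1)] is positive at both ends of [m <= k <= A - A/m]. *)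
Lemma factors_le_log A k B m : factorial_product A k B -> 8 <= m ->
  2 ^ (m - 1) <= Z.of_nat A -> Z.of_nat A + 1 <= 2 ^ m -> Z.of_nat k <= m - 1.
Proof.
  intros Hf Hm HmA HAm.
  pose proof (cofactor_bound _ _ _ m Hf HAm ltac:(lia)) as H1.
  pose proof (pow2_gt_quadratic m Hm) as H2.
  pose proof (factors_fewer _ _ _ Hf) as HkA.
  assert (He : 0 <= Z.of_nat A + 1 - m - Z.of_nat k) by nia.
  pose proof (pow_base_le_fact _ _ _ m Hf HAm ltac:(lia) He) as H3.
  pose proof (fact_am_gm A) as H4.
  set (a := Z.of_nat A) in *. set (j := Z.of_nat k) in *.
  assert (H5 : (a + 1) ^ a <= 2 ^ (m * a)).
  { rewrite Z.pow_mul_r by lia. apply Z.pow_le_mono_l. lia. }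
  assert (H6 : 2 ^ (a + j * (a + 1 - m - j)) <= 2 ^ (m * a)).
  { rewrite Z.pow_add_r by nia.
    assert (0 < 2 ^ a) by (apply Z.pow_pos_nonneg; lia). nia. }
  apply Z.pow_le_mono_r_iff in H6; [|lia|nia].
  destruct (Z_le_gt_dec j (m - 1)) as [|Hgt]; [assumption|exfalso].
  (* The right sides of [H7] and [H8] add up to [m j (a+1-m-j) - m (m-1) a], which is thus positive,
     against [H9]. *)
  assert (H7 : 0 <= (j - m) * (m * a - a - m * j)) by (apply Z.mul_nonneg_nonneg; lia).
  assert (H8 : 0 < j * (a - 2 * m * m + m)) by (apply Z.mul_pos_pos; lia).
  assert (H9 : m * (j * (a + 1 - m - j)) <= m * ((m - 1) * a)).
  { apply Z.mul_le_mono_nonneg_l; lia. }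
  lia.
Qed.

(* Nested conditionals rather than disjunctions: under call-by-value the costly last test is
   then run only when needed. *)
Definition impossible_small (A k : nat) (F : Z) : bool :=
  let a := Z.of_nat A in
  let j := Z.of_nat k in
  let m := Z.log2 a + 1 in
  if m * (a - j) <? a then true
  else if (0 <=? a + 1 - m - j) && (Z.log2 F <? j * (a + 1 - m - j)) then true
  else F <? rise k (Z.max a (- (- (4 * 2 ^ a) / ((a + 1) * 2 ^ j)) - j)).

(** The three tests contradict, in order, [cofactor_bound], [pow_base_le_fact], and the size of the
    product at the least [B] allowed by [A <= B] and [two_part_bound]. The double negation around
    the division rounds it up. *)
Lemma impossible_small_sound A k B :
  impossible_small A k (factZ A) = true -> ~ factorial_product A k B.
Proof.
  intros H Hf. unfold impossible_small in H.
  pose proof (proj1 Hf) as HA.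
  destruct (Z.log2_spec (Z.of_nat A) ltac:(lia)) as [_ Hlog].
  pose proof (Z.log2_nonneg (Z.of_nat A)) as Hlog0. unfold Z.succ in Hlog.
  set (m := Z.log2 (Z.of_nat A) + 1) in *.
  destruct (_ <? _) eqn:H1 in H; [clear H; rename H1 into H|clear H1; destruct (_ && _) eqn:H1 in H; [clear H; rename H1 into H|clear H1]].
  - apply Z.ltb_lt in H. pose proof (cofactor_bound _ _ _ m Hf ltac:(lia) ltac:(lia)). lia.
  - apply andb_prop in H as [He H]. apply Z.leb_le in He. apply Z.ltb_lt in H.
    pose proof (pow_base_le_fact _ _ _ m Hf ltac:(lia) ltac:(lia) He) as H1.
    apply Z.log2_lt_pow2 in H; [lia|]. pose proof (factZ_pos A). lia.
  - apply Z.ltb_lt in H. pose proof (two_part_bound _ _ _ Hf) as H1.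
    destruct Hf as (_ & Hk & HAB & Heq).
    set (a := Z.of_nat A) in *. set (j := Z.of_nat k) in *.
    assert (Hd : 0 < (a + 1) * 2 ^ j).
    { apply Z.mul_pos_pos; [lia|]. apply Z.pow_pos_nonneg; lia. }
    set (d := (a + 1) * 2 ^ j) in *.
    assert (Hq : - (- (4 * 2 ^ a) / d) <= B + j).
    { apply Z.opp_le_mono. rewrite Z.opp_involutive. apply Z.div_le_lower_bound; lia. }
    pose proof (rise_mono k (Z.max a (- (- (4 * 2 ^ a) / d) - j)) B ltac:(lia)). lia.
Qed.

(** The pairs [13 <= k < A <= 127] are out of reach of both the sieve and [factors_le_log]. *)
Lemma small_cases_impossible :
  forallb (fun A => let F := factZ A in
    forallb (fun k => impossible_small A k F) (seq 13 (A - 13))) (seq 14 114) = true.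
Proof. vm_cast_no_check (eq_refl true). Qed.

Lemma small_factors A k B : factorial_product A k B -> (A <= 127)%nat -> (k <= 12)%nat.
Proof.
  intros Hf HA. pose proof (factors_fewer _ _ _ Hf) as HkA.
  apply Nat.nlt_ge. intros Hk.
  pose proof small_cases_impossible as H. rewrite forallb_forall in H.
  specialize (H A). cbv zeta in H. rewrite forallb_forall in H.
  apply (impossible_small_sound A k B); [|exact Hf].
  apply H; apply in_seq; lia.
Qed.

(* The exponent is a variable so that arithmetic tactics do not evaluate the power. *)
Lemma sieve_range A k B e : factorial_product A k B -> B < 2 ^ e -> 0 <= e <= 9970 ->
  Z.of_nat A <= 9999 /\ (k <= 12)%nat.
Proof.
  intros Hf HB He9970.
  destruct (le_gt_dec A 127) as [HA|HA].
  { split; [lia|]. exact (small_factors A k B Hf HA). }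
  destruct (Z.log2_spec (Z.of_nat A) ltac:(lia)) as [HmA Hlog].
  assert (Hm : 7 <= Z.log2 (Z.of_nat A)).
  { change 7 with (Z.log2 128). apply Z.log2_le_mono. lia. }
  set (m := Z.log2 (Z.of_nat A) + 1) in *.
  replace (Z.log2 (Z.of_nat A)) with (m - 1) in * by (unfold m; lia).
  clearbody m. unfold Z.succ in Hlog. rewrite Z.sub_add in Hlog.
  pose proof (factors_le_log A k B m Hf ltac:(lia) HmA ltac:(lia)) as Hk.
  pose proof (pow2_gt_quadratic m ltac:(lia)) as Hq.
  assert (He : 0 <= Z.of_nat A + 1 - m - Z.of_nat k) by nia.
  pose proof (base_lower_bound _ _ _ m Hf ltac:(lia) ltac:(lia) He) as Hlow.
  assert (HA1 : Z.of_nat A + 1 - m - Z.of_nat k < 9970).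
  { apply (Z.lt_le_trans _ e); [|lia]. apply (Z.pow_lt_mono_r_iff 2); lia. }
  (* For [m >= 15], [A >= 2^(m-1)] exceeds [2m + 10000], while [HA1] and [k <= m - 1] give
     [A < 9970 + 2m]. *)
  assert (Hm14 : m <= 14).
  { destruct (Z_le_gt_dec m 14) as [|Hgt]; [assumption|exfalso].
    assert (2 * m + 10000 < 2 ^ (m - 1)); [|lia].
    clear - Hgt. assert (15 <= m) as Hm by lia. clear Hgt. pattern m.
    apply Zlt_lower_bound_ind with (z := 15); [|exact Hm].
    intros x IH Hx. destruct (Z.eq_dec x 15) as [->|Hne]; [reflexivity|].
    specialize (IH (x - 1) ltac:(lia)). replace (x - 1) with (Z.succ (x - 1 - 1)) by lia.
    rewrite Z.pow_succ_r by lia. lia. }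
  split; [lia|]. clear e HB He9970 Hlow.
  destruct (le_gt_dec k 12) as [|Hk13]; [assumption|exfalso].
  assert (m = 14) by lia. assert (k = 13)%nat by lia. subst m k.
  change (2 ^ (14 - 1)) with 8192 in HmA.
  pose proof (pow_base_le_fact _ _ _ 14 Hf ltac:(lia) ltac:(lia) He) as H1.
  pose proof (fact_am_gm A) as H2. set (a := Z.of_nat A) in *.
  change (Z.of_nat 13) with 13 in *.
  assert (H3 : 2 ^ (a + 13 * (a + 1 - 14 - 13)) <= 10000 ^ a).
  { rewrite Z.pow_add_r by lia. assert (0 < 2 ^ a) by (apply Z.pow_pos_nonneg; lia).
    assert ((a + 1) ^ a <= 10000 ^ a) by (apply Z.pow_le_mono_l; lia). nia. }
  (* As [10000^10 <= 2^133], this yields [7A <= 3380], against [A >= 8192]. *)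
  assert (H4 : 2 ^ ((a + 13 * (a + 1 - 14 - 13)) * 10) <= 2 ^ (133 * a)).
  { rewrite Z.pow_mul_r by lia. apply (Z.le_trans _ ((10000 ^ a) ^ 10)).
    - apply Z.pow_le_mono_l. split; [apply Z.pow_nonneg|]; lia.
    - rewrite <- Z.pow_mul_r, Z.mul_comm, Z.pow_mul_r, (Z.pow_mul_r 2) by lia.
      apply Z.pow_le_mono_l. split; [lia|]. apply Z.leb_le. reflexivity. }
  apply Z.pow_le_mono_r_iff in H4; lia.
Qed.

(** Comparing tenth roots, [10^300 <= 2^997], keeps the evaluated numbers small. *)
Lemma ten_pow_3000_le : 10 ^ 3000 <= 2 ^ 9970.
Proof.
  change 3000 with (300 * 10). change 9970 with (997 * 10).
  rewrite (Z.pow_mul_r 10 300 10), (Z.pow_mul_r 2 997 10) by discriminate.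
  apply Z.pow_le_mono_l. split; [apply Z.pow_nonneg; discriminate|].
  apply Z.leb_le. vm_cast_no_check (eq_refl true).
Qed.

(** The sieve leaves the exceptional pairs, and [rise k] is strictly increasing, so each determines
    [B]. Only [A = 6], [k = 3] satisfies both [k < A] and [A <= B]. *)
Lemma small_solution A k B : factorial_product A k B -> B < 10 ^ 3000 ->
  A = 6%nat /\ k = 3%nat /\ B = 7.
Proof.
  intros Hf HB.
  destruct (sieve_range A k B _ Hf (Z.lt_le_trans _ _ _ HB ten_pow_3000_le) (conj (Pos2Z.is_nonneg _) (Z.le_refl _))) as [HA Hk].
  clear HB.
  pose proof (factors_fewer _ _ _ Hf) as HkA. destruct Hf as (HA1 & Hk2 & HAB & Heq).
  pose proof (sieve_sound A k B HA1 HA ltac:(lia) Heq) as Hex.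
  assert (Huniq : forall x, 0 <= x -> factZ A = rise k x -> B = x).
  { intros x Hx Hr. rewrite Heq in Hr.
    destruct (Z.lt_trichotomy B x) as [Hl|[Hl|Hl]]; [|exact Hl|].
    - pose proof (rise_strict k B x ltac:(lia) ltac:(lia)). lia.
    - pose proof (rise_strict k x B ltac:(lia) ltac:(lia)). lia. }
  unfold exceptional in Hex. apply andb_prop in Hex as [_ Hex].
  repeat rewrite orb_true_iff in Hex. repeat rewrite andb_true_iff in Hex.
  repeat rewrite Pos.eqb_eq in Hex.
  destruct Hex as [[[[H|H]|[H1 H2]]|[H1 H2]]|[H1 H2]].
  - lia.
  - assert (A = S k) by lia. subst A. exfalso.
    assert (B = 1); [|lia]. apply Huniq; [lia|].
    pose proof (factZ_add 1 k) as Hadd. cbn [Nat.add] in Hadd. rewrite Hadd.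
    change (factZ 1) with 1. change (Z.of_nat 1) with 1. lia.
  - assert (A = 5%nat) by lia. assert (k = 3%nat) by lia. subst. exfalso.
    assert (B = 3); [|lia]. apply Huniq; [lia|reflexivity].
  - assert (A = 6%nat) by lia. assert (k = 3%nat) by lia. subst.
    repeat split. apply Huniq; [lia|reflexivity].
  - assert (A = 7%nat) by lia. assert (k = 4%nat) by lia. subst. exfalso.
    assert (B = 6); [|lia]. apply Huniq; [lia|reflexivity].
Qed.

Close Scope Z_scope.
Local Open Scope R_scope.

(** * Real estimates *)

(** Each Taylor bound for the exponential below is integrated by this from the one of lower
    degree. *)
Lemma nonneg_of_derivative (f f' : R -> R) :
  f 0 = 0 -> (forall x, 0 <= x -> derivable_pt_lim f x (f' x)) ->
  (forall x, 0 <= x -> 0 <= f' x) -> forall u, 0 <= u -> 0 <= f u.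
Proof.
  intros H0 Hd Hp u Hu. destruct (Rle_lt_or_eq_dec 0 u Hu) as [Hlt|<-]; [|lra].
  destruct (MVT_cor2 f f' 0 u Hlt) as (c & Hc & Hc'); [intros c Hc; apply Hd; lra|].
  pose proof (Hp c ltac:(lra)). nra.
Qed.

Lemma derivable_cubic a0 a1 a2 a3 x :
  derivable_pt_lim (fun x => a0 + a1 * x + a2 * x ^ 2 + a3 * x ^ 3) x (a1 + 2 * a2 * x + 3 * a3 * x ^ 2).
Proof.
  replace (a1 + 2 * a2 * x + 3 * a3 * x ^ 2)
    with (0 + a1 * 1 + a2 * (INR 2 * x ^ 1) + a3 * (INR 3 * x ^ 2)) by (simpl; ring).
  apply (derivable_pt_lim_plus (fun x => a0 + a1 * x + a2 * x ^ 2) (fun x => a3 * x ^ 3)).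
  - apply (derivable_pt_lim_plus (fun x => a0 + a1 * x) (fun x => a2 * x ^ 2)).
    + apply (derivable_pt_lim_plus (fun x => a0) (fun x => a1 * x)).
      * apply (derivable_pt_lim_const a0).
      * apply (derivable_pt_lim_scal id), derivable_pt_lim_id.
    + apply (derivable_pt_lim_scal (fun x => x ^ 2)), (derivable_pt_lim_pow x 2).
  - apply (derivable_pt_lim_scal (fun x => x ^ 3)), (derivable_pt_lim_pow x 3).
Qed.

Lemma derivable_exp_opp x : derivable_pt_lim (fun x => exp (- x)) x (- exp (- x)).
Proof.
  replace (- exp (- x)) with (exp (- x) * - (1)) by ring.
  apply (derivable_pt_lim_comp (fun x => - x) exp).
  - apply (derivable_pt_lim_opp id), derivable_pt_lim_id.
  - apply derivable_pt_lim_exp.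
Qed.

Lemma exp_ge_quadratic u : 0 <= u -> 1 + u + u ^ 2 / 2 <= exp u.
Proof.
  intros Hu.
  enough (0 <= exp u - (1 + 1 * u + / 2 * u ^ 2 + 0 * u ^ 3)) by lra.
  apply (nonneg_of_derivative (fun x => exp x - (1 + 1 * x + / 2 * x ^ 2 + 0 * x ^ 3))
           (fun x => exp x - (1 + 2 * / 2 * x + 3 * 0 * x ^ 2))); [rewrite exp_0; ring| | |exact Hu].
  - intros x _. apply (derivable_pt_lim_minus exp), derivable_cubic. apply derivable_pt_lim_exp.
  - intros x _. pose proof (exp_ineq1_le x). lra.
Qed.

Lemma exp_ge_cubic u : 0 <= u -> 1 + u + u ^ 2 / 2 + u ^ 3 / 6 <= exp u.
Proof.
  intros Hu.
  enough (0 <= exp u - (1 + 1 * u + / 2 * u ^ 2 + / 6 * u ^ 3)) by lra.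
  apply (nonneg_of_derivative (fun x => exp x - (1 + 1 * x + / 2 * x ^ 2 + / 6 * x ^ 3))
           (fun x => exp x - (1 + 2 * / 2 * x + 3 * / 6 * x ^ 2))); [rewrite exp_0; ring| | |exact Hu].
  - intros x _. apply (derivable_pt_lim_minus exp), derivable_cubic. apply derivable_pt_lim_exp.
  - intros x Hx. pose proof (exp_ge_quadratic x Hx). lra.
Qed.

Lemma exp_opp_le_quadratic u : 0 <= u -> exp (- u) <= 1 - u + u ^ 2 / 2.
Proof.
  intros Hu.
  enough (0 <= (1 + -1 * u + / 2 * u ^ 2 + 0 * u ^ 3) - exp (- u)) by lra.
  apply (nonneg_of_derivative (fun x => (1 + -1 * x + / 2 * x ^ 2 + 0 * x ^ 3) - exp (- x))
           (fun x => (-1 + 2 * / 2 * x + 3 * 0 * x ^ 2) - - exp (- x))); [rewrite Ropp_0, exp_0; ring| | |exact Hu].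
  - intros x _. apply (derivable_pt_lim_minus _ (fun x => exp (- x)));
      [apply derivable_cubic|apply derivable_exp_opp].
  - intros x _. pose proof (exp_ineq1_le (- x)). lra.
Qed.

Lemma exp_opp_ge_cubic u : 0 <= u -> 1 - u + u ^ 2 / 2 - u ^ 3 / 6 <= exp (- u).
Proof.
  intros Hu.
  enough (0 <= exp (- u) - (1 + -1 * u + / 2 * u ^ 2 + - / 6 * u ^ 3)) by lra.
  apply (nonneg_of_derivative (fun x => exp (- x) - (1 + -1 * x + / 2 * x ^ 2 + - / 6 * x ^ 3))
           (fun x => - exp (- x) - (-1 + 2 * / 2 * x + 3 * - / 6 * x ^ 2))); [rewrite Ropp_0, exp_0; ring| | |exact Hu].
  - intros x _. apply (derivable_pt_lim_minus (fun x => exp (- x)));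
      [apply derivable_exp_opp|apply derivable_cubic].
  - intros x Hx. pose proof (exp_opp_le_quadratic x Hx). lra.
Qed.

(** Argument reduction: a cubic Taylor bound at a small argument, rounded down to [l], is raised to
    the power [n]. *)
Lemma exp_ge_pow l u n : 0 <= l -> l <= exp u -> l ^ n <= exp (INR n * u).
Proof.
  intros Hl Hle. replace (exp (INR n * u)) with (exp u ^ n); [now apply pow_incr|].
  rewrite <- Rpower_pow by apply exp_pos. unfold Rpower. now rewrite ln_exp.
Qed.

(** * Numerical values and growth of the logarithm *)

Lemma ln_le_of_exp x y : 0 < x -> x <= exp y -> ln x <= y.
Proof.
  intros Hx H. rewrite <- (ln_exp y). destruct H as [H| ->]; [|lra]. left. now apply ln_increasing.
Qed.

Lemma ln_ge_of_exp x y : 0 < x -> / x <= exp (- y) -> y <= ln x.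
Proof.
  intros Hx H. assert (Hi : 0 < / x) by now apply Rinv_0_lt_compat.
  pose proof (ln_le_of_exp _ _ Hi H) as H1. rewrite ln_Rinv in H1 by exact Hx. lra.
Qed.

Lemma ln_le x y : 0 < x -> x <= y -> ln x <= ln y.
Proof. intros Hx [H| ->]; [left; now apply ln_increasing|lra]. Qed.

Lemma ln2_lower : 0.69314 <= ln 2.
Proof.
  apply ln_ge_of_exp; [lra|].
  apply (Rle_trans _ (0.9785722 ^ 32)); [lra|].
  replace (- (0.69314)) with (INR 32 * (- (0.69314 / 32))) by (simpl; lra).
  apply exp_ge_pow; [lra|].
  eapply Rle_trans; [|apply (exp_opp_ge_cubic (0.69314 / 32)); lra]. lra.
Qed.

Lemma ln2_upper : ln 2 <= 0.69315.
Proof.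
  apply ln_le_of_exp; [lra|].
  apply (Rle_trans _ (1.0218972 ^ 32)); [lra|].
  replace 0.69315 with (INR 32 * (0.69315 / 32)) by (simpl; lra).
  apply exp_ge_pow; [lra|].
  eapply Rle_trans; [|apply (exp_ge_cubic (0.69315 / 32)); lra]. lra.
Qed.

Lemma ln_ln2_lower : -0.36653 <= ln (ln 2).
Proof.
  pose proof ln2_lower as H. apply ln_ge_of_exp; [lra|].
  apply (Rle_trans _ (/ 0.69314)); [apply Rinv_le_contravar; lra|].
  apply (Rle_trans _ (1.0231722 ^ 16)); [lra|].
  replace (- (-0.36653)) with (INR 16 * (0.36653 / 16)) by (simpl; lra).
  apply exp_ge_pow; [lra|].
  eapply Rle_trans; [|apply (exp_ge_cubic (0.36653 / 16)); lra]. lra.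
Qed.

Lemma ln10_lower : 2.3025 <= ln 10.
Proof.
  apply ln_ge_of_exp; [lra|].
  apply (Rle_trans _ (0.930573 ^ 32)); [lra|].
  replace (- (2.3025)) with (INR 32 * (- (2.3025 / 32))) by (simpl; lra).
  apply exp_ge_pow; [lra|].
  eapply Rle_trans; [|apply (exp_opp_ge_cubic (2.3025 / 32)); lra]. lra.
Qed.

(** The number 6907 is the integer part of [3000 * ln 10], a lower bound for [log(B+1)] once
    [B >= 10^3000]. *)
Lemma ln_6907_bounds : 8 <= ln 6907 <= 8.841.
Proof.
  pose proof ln2_lower as Hl. pose proof ln2_upper as Hu. split.
  - apply (Rle_trans _ (ln (2 ^ 12))).
    + rewrite ln_pow by lra. simpl (INR 12). lra.
    + apply ln_le; lra.
  - assert (H : ln (6907 / 2 ^ 13) <= - (0.16995)).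
    { apply ln_le_of_exp; [lra|].
      eapply Rle_trans; [|apply (exp_opp_ge_cubic 0.16995); lra]. lra. }
    unfold Rdiv in H. rewrite ln_mult, ln_Rinv, ln_pow in H by lra. simpl (INR 13) in H. lra.
Qed.

(** With [x = 6907 * exp t], the left sides become polynomials of degree at most 2 in [t], dominated
    through [exp t >= 1 + t + t^2/2]. *)
Lemma ln_growth x : 6907 <= x ->
  8 <= ln x /\ ln x <= 0.00129 * x /\
  2 * ln x ^ 2 - 0.158 * ln x + 0.364 <= 0.02325 * x.
Proof.
  intros Hx. pose proof ln_6907_bounds as H0.
  set (t := ln (x / 6907)).
  assert (Hpos : 0 < x / 6907) by (apply Rdiv_lt_0_compat; lra).
  assert (Ht : 0 <= t).
  { unfold t. rewrite <- ln_1. apply ln_le; [lra|]. apply (Rmult_le_reg_r 6907); [lra|].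
    replace (x / 6907 * 6907) with x by field. lra. }
  assert (Hln : ln x = ln 6907 + t).
  { unfold t. rewrite <- ln_mult by lra. f_equal. field. }
  assert (Hexp : x = 6907 * exp t).
  { unfold t. rewrite exp_ln by exact Hpos. field. }
  pose proof (exp_ge_quadratic t Ht) as He.
  rewrite Hln. set (y0 := ln 6907) in *. clearbody y0 t.
  repeat split; [lra|nra|nra].
Qed.

(** * Asymptotic inequalities, with [x = log(B+1)], [a = A] and [j = k] *)

Lemma weighted_ln_mono a u : 0 < a -> a <= u -> 1 <= ln u ->
  (a + 1) * ln a - a <= (u + 1) * ln u - u.
Proof.
  (* The difference is [(u - a)(ln u - 1) + (a + 1)(ln u - ln a)]. *)
  intros Ha Hau Hu. pose proof (ln_le a u Ha Hau). nra.
Qed.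

Lemma ln_succ_le a : 0 < a -> ln (a + 1) <= ln a + / a.
Proof.
  intros Ha. replace (a + 1) with (a * (1 + / a)) by (field; lra).
  assert (0 < / a) by now apply Rinv_0_lt_compat.
  rewrite ln_mult by lra. apply Rplus_le_compat_l, ln_le_of_exp; [lra|]. apply exp_ineq1_le.
Qed.

Lemma ln_perturbed x d : 0 < x -> 0 <= d -> ln ((x + d) / ln 2) <= ln x + d / x + 0.36653.
Proof.
  intros Hx Hd. pose proof ln2_lower as Hc. pose proof ln_ln2_lower as Hlc.
  unfold Rdiv at 1. rewrite ln_mult, ln_Rinv; [|lra|lra|apply Rinv_0_lt_compat; lra].
  replace (x + d) with (x * (1 + d / x)) by (field; lra).
  assert (0 <= d / x) by (apply Rle_mult_inv_pos; lra).
  rewrite ln_mult by lra.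
  assert (ln (1 + d / x) <= d / x) by (apply ln_le_of_exp; [lra|apply exp_ineq1_le]). lra.
Qed.

Lemma ratio_bound x d : 6907 <= x -> d <= 2 * ln x - 1.59 -> d / x <= 0.00258.
Proof.
  intros Hx Hd. destruct (ln_growth x Hx) as (_ & H & _).
  apply (Rmult_le_reg_r x); [lra|]. replace (d / x * x) with d by (field; lra). lra.
Qed.

(** Dividing the bound on [j * x] by [x] gives the main term [ln x - 1 - ln (ln 2)]. Since
    [1 + ln (ln 2) > 0.6334] and [0.8803 ln 2 < 0.6102], a gap of about 0.023 remains to absorb the
    terms of order [(ln x)^2 / x], as estimated in [ln_growth]. *)
Lemma factors_bound a j x d : 6907 <= x -> 0 < a -> 0 <= d <= 2 * ln x - 1.59 ->
  a * ln 2 <= x + d -> j * x <= (a + 1) * ln a - a + 1 ->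
  j * ln 2 <= ln x - 0.8803 * ln 2.
Proof.
  intros Hx Ha Hd Had Hj.
  destruct (ln_growth x Hx) as (H8 & Hlin & Hquad).
  pose proof ln2_lower as Hc. pose proof ln2_upper as Hc'.
  pose proof (ln_perturbed x d ltac:(lra) ltac:(lra)) as Hlnu.
  pose proof (ratio_bound x d Hx ltac:(lra)) as Hr.
  set (u := (x + d) / ln 2) in *.
  assert (Huc : u * ln 2 = x + d) by (unfold u; field; lra).
  assert (Hau : a <= u) by (apply (Rmult_le_reg_r (ln 2)); lra).
  assert (Hu1 : 1 <= ln u).
  { apply (Rle_trans _ (ln x)); [lra|]. apply ln_le; [lra|].
    apply (Rmult_le_reg_r (ln 2)); [lra|]. nra. }
  pose proof (weighted_ln_mono a u Ha Hau Hu1) as Hm.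
  set (c := ln 2) in *. set (y := ln x) in *. set (w := ln u) in *. set (r := d / x) in *.
  assert (Hrx : r * x = d) by (unfold r; field; lra).
  clearbody c y w r.
  assert (Hjc : j * c * x <= (x + d + c) * w - (x + d) + c).
  { rewrite <- Huc.
    assert (j * x * c <= ((u + 1) * w - u + 1) * c) by (apply Rmult_le_compat_r; lra). lra. }
  assert (Hw : (x + d + c) * w <= (x + d + c) * (y + r + 0.36653)) by (apply Rmult_le_compat_l; lra).
  (* Here [0.89685 = 1.59 - 0.69315] and [0.36911 = 0.36653 + 0.00258]. *)
  assert (Hdc : (d + c) * (y + r + 0.36653) <= (2 * y - 0.89685) * (y + 0.36911)).
  { apply Rmult_le_compat; lra. }
  apply (Rmult_le_reg_r x); [lra|].
  assert (Hxr : x * (y + r + 0.36653) = x * y + d + 0.36653 * x) by (rewrite <- Hrx; ring).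
  assert (c * x <= 0.69315 * x) by (apply Rmult_le_compat_r; lra).
  nra.
Qed.

(** The main term is [ln a - 1]; the slack 0.05 pays for the weak hypothesis on [a]. The result then
    sharpens that hypothesis enough for [factors_bound]. *)
Lemma crude_factors_bound a j x : 6907 <= a -> x <= a * ln 2 -> 6907 <= x ->
  a * ln 2 <= x + 2 * ln a -> j * x <= (a + 1) * ln a - a + 1 -> 0 <= j ->
  j * ln 2 <= ln a - 0.95.
Proof.
  intros Ha Hxa Hx Hax Hj Hj0. destruct (ln_growth a Ha) as (H8 & _ & Hquad).
  pose proof ln2_lower as Hc. pose proof ln2_upper as Hc'.
  set (c := ln 2) in *. set (w := ln a) in *. clearbody c w.
  apply Rnot_lt_le. intros Hlt.
  assert (H1 : j * c * x <= c * ((a + 1) * w - a + 1)) by nra.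
  assert (H2 : (w - 0.95) * x <= j * c * x) by (apply Rmult_le_compat_r; lra).
  assert (H3 : (w - 0.95) * (a * c - 2 * w) <= (w - 0.95) * x) by (apply Rmult_le_compat_l; lra).
  assert (H4 : a * 0.69314 <= a * c) by (apply Rmult_le_compat_l; lra).
  assert (H5 : 0.05 * (a * c) <= c * (w + 1) + 2 * w * (w - 0.95)) by lra.
  assert (H6 : c * (w + 1) <= 0.69315 * (w + 1)) by (apply Rmult_le_compat_r; lra).
  lra.
Qed.

Lemma analytic_bounds a j x : 6907 <= x -> 1 <= a -> 0 <= j ->
  a * ln 2 + 2 * ln 2 <= ln (a + 1) + j * ln 2 + x + 0.001 ->
  j * x <= (a + 1) * ln a - a + 1 ->
  (128 <= a -> j * ln 2 <= ln a) ->
  j * ln 2 <= ln x - 0.8803 * ln 2 /\ a * ln 2 <= x + 2 * ln x - 1.3479 * ln 2.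
Proof.
  intros Hx Ha Hj H1 H2 H3.
  destruct (ln_growth x Hx) as (H8 & Hlin & Hquad).
  pose proof ln2_lower as Hc. pose proof ln2_upper as Hc'.
  (* If [a ln 2 <= x], the second bound is immediate and the first is the case [d = 0]. Otherwise
     the excess [e = a ln 2 - x] is bounded in two rounds. *)
  destruct (Rle_lt_dec (a * ln 2) x) as [Hax|Hax].
  - split; [|lra]. apply (factors_bound a j x 0); lra.
  - assert (Ha6907 : 6907 <= a) by nra.
    specialize (H3 ltac:(lra)).
    pose proof (ln_succ_le a ltac:(lra)) as Hs.
    assert (Hinv : / a <= 0.0002).
    { apply (Rle_trans _ (/ 6907)); [apply Rinv_le_contravar; lra|lra]. }
    pose proof (crude_factors_bound a j x Ha6907 ltac:(lra) Hx ltac:(lra) H2 Hj) as H4.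
    set (e := a * ln 2 - x).
    pose proof (ln_perturbed x e ltac:(lra) ltac:(unfold e; lra)) as H5.
    replace ((x + e) / ln 2) with a in H5 by (unfold e; field; lra).
    assert (Hex : e / x * x = e) by (field; lra).
    set (r := e / x) in *.
    assert (He : e <= 2 * ln a - 2.335) by (unfold e; lra).
    assert (Hr : r <= 0.0027).
    { assert (Hr0 : 0 <= r) by (apply Rle_mult_inv_pos; unfold e; lra).
      assert (r * 6907 <= r * x) by (apply Rmult_le_compat_l; lra).
      apply (Rmult_le_reg_r x); [lra|]. lra. }
    (* Passing from [ln a] to [ln x] costs [2 (0.36653 + 0.0027)], less than [2.335 - 1.59]. *)
    assert (Hd : e <= 2 * ln x - 1.59) by lra.
    pose proof (factors_bound a j x e Hx ltac:(lra) ltac:(split; [unfold e; lra|exact Hd]) ltac:(unfold e; lra) H2) as H6.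
    split; [exact H6|]. lra.
Qed.

(** * Solutions of [A! B! = C!] *)

Lemma ln_pow_IZR z n : (0 < z)%Z -> ln (IZR (z ^ Z.of_nat n)) = INR n * ln (IZR z).
Proof. intros Hz. rewrite <- pow_IZR. apply ln_pow. now apply IZR_lt. Qed.

Lemma ln_IZR_le z t : (0 < z <= t)%Z -> ln (IZR z) <= ln (IZR t).
Proof. intros [Hz Hzt]. apply ln_le; [now apply IZR_lt|now apply IZR_le]. Qed.

(** The form [n! <= e n (n/e)^n] of Stirling's estimate; its inductive step is
    [(n+1) ln (n/(n+1)) <= -1]. *)
Lemma ln_fact_le n : (1 <= n)%nat -> ln (IZR (factZ n)) <= (INR n + 1) * ln (INR n) - INR n + 1.
Proof.
  induction n as [|n IH]; intros Hn; [lia|].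
  destruct (Nat.eq_dec n 0) as [->|Hn0].
  { change (factZ 1) with 1%Z. simpl INR. rewrite ln_1. lra. }
  specialize (IH ltac:(lia)).
  assert (Hpos : 0 < INR n) by (apply lt_0_INR; lia).
  rewrite factZ_succ, mult_IZR, <- INR_IZR_INZ, ln_mult;
    [|apply lt_0_INR; lia|apply IZR_lt; pose proof (factZ_pos n); lia].
  rewrite S_INR. set (t := INR n) in *. clearbody t.
  assert (H : ln (t / (t + 1)) <= - (1 / (t + 1))).
  { apply ln_le_of_exp; [apply Rdiv_lt_0_compat; lra|].
    eapply Rle_trans; [|apply exp_ineq1_le]. right. field. lra. }
  unfold Rdiv at 1 in H. rewrite ln_mult, ln_Rinv in H by (try apply Rinv_0_lt_compat; lra).
  assert (H1 : (t + 1) * (ln t - ln (t + 1)) <= (t + 1) * - (1 / (t + 1))) by (apply Rmult_le_compat_l; lra).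
  replace ((t + 1) * - (1 / (t + 1))) with (-1) in H1 by (field; lra). lra.
Qed.

Lemma factorial_product_of_solution A B C : nontrivial_solution A B C ->
  factorial_product A (C - B) (Z.of_nat B).
Proof.
  intros (HA & HAB & HBC & Heq). repeat split; try lia.
  pose proof (factZ_add B (C - B)) as H. replace (B + (C - B))%nat with C in H by lia.
  assert (HZ : (factZ A * factZ B = factZ C)%Z).
  { rewrite !factZ_fact, <- Nat2Z.inj_mul. now f_equal. }
  pose proof (factZ_pos B). rewrite H, Z.mul_comm in HZ. apply Z.mul_reg_l in HZ; lia.
Qed.

Lemma ln_ge_of_pow10_le e B : (0 <= e)%Z -> (10 ^ e <= Z.of_nat B)%Z -> IZR e * ln 10 <= ln (INR B + 1).
Proof.
  intros He HB. rewrite <- (Z2Nat.id e He), <- INR_IZR_INZ, <- ln_pow_IZR by lia.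
  rewrite Z2Nat.id by exact He.
  replace (INR B + 1) with (IZR (Z.of_nat B + 1)) by (rewrite plus_IZR, <- INR_IZR_INZ; reflexivity).
  apply ln_IZR_le. split; [apply Z.pow_pos_nonneg|]; lia.
Qed.

Lemma solution_bounds A k B : factorial_product A k (Z.of_nat B) -> 6907 <= ln (INR B + 1) ->
  INR k * ln 2 <= ln (ln (INR B + 1)) - 0.8803 * ln 2 /\
  INR A * ln 2 <= ln (INR B + 1) + 2 * ln (ln (INR B + 1)) - 1.3479 * ln 2.
Proof.
  intros Hf Hx. set (x := ln (INR B + 1)) in *.
  pose proof (factors_fewer _ _ _ Hf) as HkA.
  pose proof (two_part_bound _ _ _ Hf) as Htwo.
  assert (Hlog : 128 <= INR A -> INR k * ln 2 <= ln (INR A)).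
  { intros HA. rewrite INR_IZR_INZ in HA. apply (le_IZR 128) in HA.
    destruct (Z.log2_spec (Z.of_nat A) ltac:(lia)) as [Hl1 Hl2]. unfold Z.succ in Hl2.
    assert (Hl : (7 <= Z.log2 (Z.of_nat A))%Z).
    { change 7%Z with (Z.log2 128). apply Z.log2_le_mono. lia. }
    pose proof (factors_le_log A k _ (Z.log2 (Z.of_nat A) + 1) Hf) as Hk.
    rewrite Z.add_simpl_r in Hk. specialize (Hk ltac:(lia) Hl1 ltac:(lia)).
    rewrite <- (ln_pow_IZR 2 k), (INR_IZR_INZ A) by lia. apply ln_IZR_le.
    split; [apply Z.pow_pos_nonneg; lia|].
    apply (Z.le_trans _ (2 ^ Z.log2 (Z.of_nat A))); [apply Z.pow_le_mono_r; lia|exact Hl1]. }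
  destruct Hf as (HA & Hk & HAB & Heq).
  assert (HA1 : 1 <= INR A) by (apply (le_INR 1); lia).
  assert (HB1 : INR A <= INR B) by (apply le_INR; lia).
  assert (Hexp : INR B + 1 = exp x) by (unfold x; rewrite exp_ln; lra).
  pose proof (exp_ge_quadratic x ltac:(lra)) as Hexp2. rewrite <- Hexp in Hexp2.
  pose proof ln2_lower as Hc.
  (* This crude bound makes [k] negligible beside [B + 1 = exp x], so that replacing [B + k] by
     [B + 1] costs at most 0.001 in the logarithm. *)
  assert (Hkx : INR k <= 2 * x).
  { destruct (Rle_lt_dec 128 (INR A)) as [H|H].
    - specialize (Hlog H). pose proof (ln_le (INR A) (INR B + 1) ltac:(lra) ltac:(lra)). fold x in H0. nra.
    - assert (INR k <= INR A) by (apply le_INR; lia). lra. }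
  assert (HlnC : ln (INR B + INR k) <= x + 0.001).
  { replace (x + 0.001) with (ln (exp (x + 0.001))) by apply ln_exp.
    apply ln_le; [pose proof (pos_INR k); lra|].
    rewrite exp_plus, <- Hexp. pose proof (exp_ineq1_le 0.001).
    assert ((INR B + 1) * (1 + 0.001) <= (INR B + 1) * exp 0.001) by (apply Rmult_le_compat_l; lra).
    assert (6907 * x <= x * x) by (apply Rmult_le_compat_r; lra). lra. }
  apply analytic_bounds; [exact Hx|exact HA1|apply pos_INR| | |exact Hlog].
  - apply (Rle_trans _ (ln (INR A + 1) + INR k * ln 2 + ln (INR B + INR k))); [|lra].
    assert (H4 : (0 < 4 * 2 ^ Z.of_nat A)%Z) by (apply Z.mul_pos_pos; [lia|apply Z.pow_pos_nonneg; lia]).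
    pose proof (ln_IZR_le _ _ (conj H4 Htwo)) as H.
    rewrite !mult_IZR, !plus_IZR, <- !INR_IZR_INZ in H.
    assert (Hp : forall n, 0 < IZR (2 ^ Z.of_nat n)) by (intros n; apply IZR_lt, Z.pow_pos_nonneg; lia).
    pose proof (pos_INR k).
    rewrite !ln_mult, !ln_pow_IZR in H; [| lia | lia | lra | apply Hp | apply Rmult_lt_0_compat; [lra|apply Hp] | lra | lra | apply Hp].
    replace (ln 4) with (2 * ln 2) in H; [lra|].
    replace 4 with (2 * 2) by ring. rewrite ln_mult by lra. ring.
  - apply (Rle_trans _ (ln (IZR (factZ A)))); [|now apply ln_fact_le].
    unfold x. replace (INR B + 1) with (IZR (Z.of_nat B + 1)) by (rewrite plus_IZR, <- INR_IZR_INZ; reflexivity).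
    rewrite <- ln_pow_IZR by lia. apply ln_IZR_le.
    split; [apply Z.pow_pos_nonneg; lia|]. rewrite Heq. apply pow_le_rise. lia.
Qed.

Theorem theorem4 (A B C : nat)
  (hsol : nontrivial_solution A B C)
  (hne : (A, B, C) <> (6, 7, 10)%nat) :
  (10 ^ 3000 <= Z.of_nat B)%Z /\
  INR A <= ln (INR B + 1) / ln 2 + 2 * ln (ln (INR B + 1)) / ln 2 - 1.3479 /\
  INR C - INR B <= ln (ln (INR B + 1)) / ln 2 - 0.8803 /\
  INR B - INR A >
    INR C - ln (INR C + 1) / ln 2 - 3 * ln (ln (INR C + 1)) / ln 2 + 2.2282.
Proof.
  pose proof (factorial_product_of_solution A B C hsol) as Hf.
  assert (HBC : (B + 2 <= C)%nat) by apply hsol.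
  assert (HB : (10 ^ 3000 <= Z.of_nat B)%Z).
  { apply Z.nlt_ge. intros Hlt. destruct (small_solution _ _ _ Hf Hlt) as (HA & Hk & HB).
    clear Hlt. apply hne. replace A with 6%nat by lia. replace B with 7%nat by lia.
    replace C with 10%nat by lia. reflexivity. }
  split; [exact HB|].
  assert (Hx : 6907 <= ln (INR B + 1)).
  { pose proof (ln_ge_of_pow10_le 3000 B (Pos2Z.is_nonneg _) HB) as H. clear HB.
    pose proof ln10_lower. lra. }
  clear HB hne hsol.
  destruct (solution_bounds A (C - B) B Hf Hx) as [Hk HA].
  rewrite minus_INR in Hk by lia.
  assert (HC : ln (INR B + 1) < ln (INR C + 1)).
  { apply ln_increasing; [pose proof (pos_INR B); lra|].
    pose proof (lt_INR B C ltac:(lia)). lra. }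
  assert (HlC : ln (ln (INR B + 1)) < ln (ln (INR C + 1))) by (apply ln_increasing; lra).
  pose proof ln2_lower as Hc.
  set (x := ln (INR B + 1)) in *. set (z := ln (INR C + 1)) in *.
  assert (Hdiv : forall u v, u * ln 2 <= v -> u <= v / ln 2).
  { intros u v Huv. apply (Rmult_le_reg_r (ln 2)); [lra|].
    replace (v / ln 2 * ln 2) with v by (field; lra). exact Huv. }
  assert (Hdiv' : forall u v, u * ln 2 < v -> u < v / ln 2).
  { intros u v Huv. apply (Rmult_lt_reg_r (ln 2)); [lra|].
    replace (v / ln 2 * ln 2) with v by (field; lra). exact Huv. }
  repeat split.
  - enough (INR A + 1.3479 <= (x + 2 * ln x) / ln 2) by lra. apply Hdiv. lra.
  - enough (INR C - INR B + 0.8803 <= ln x / ln 2) by lra. apply Hdiv. lra.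
  (* The two previous bounds are added, [2.2282 = 1.3479 + 0.8803]; passing from [B] to [C] makes
     the inequality strict. *)
  - enough (INR A + (INR C - INR B) + 2.2282 < (z + 3 * ln z) / ln 2) by lra. apply Hdiv'. lra.
Qed.
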